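(* Let $\mathcal{H}$ be a finite-dimensional vector space over some field $\mathbb{F}$. Let $G\subset\mathrm{GL}(\mathcal{H})$ be a Zariski-connected subgroup whose action on $\mathcal{H}$ is irreducible. Then for all subspaces $V,W\subseteq\mathcal{H}$, one has $$\min_{g\in G}\dim(gV\cap W)\le\frac{\dim V\,\dim W}{\dim\mathcal{H}}.$$
   Context: The field $\mathbb{F}$ is arbitrary (any characteristic, not necessarily algebraically closed). $G$ is not assumed to be Zariski-closed; Zariski-connected means connected for the topology induced by the Zariski topology on $\mathrm{GL}(\mathcal{H})$. *)

(* Defs.v *)
From HB Require Import structures.
From mathcomp Require Import all_boot all_order all_algebra.
From mathcomp Require Import boolp classical_sets topology.
(* The notations of mpoly clash with those of topology. *)
From mathcomp Require Import -(notations) mpoly.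

Set Implicit Arguments.
Unset Strict Implicit.
Unset Printing Implicit Defensive.

Import GRing.Theory.
Local Open Scope ring_scope.
Local Open Scope classical_set_scope.

(* The value at v of a polynomial in the coordinates on V with respect to
   vbasis {:V}.  A change of basis is a linear substitution of the variables,
   so the resulting class of functions V -> F does not depend on the basis. *)
Definition peval (F : fieldType) (V : vectType F)
    (p : mpoly (\dim {:V}) F) (v : V) : F :=
  meval (fun i => coord (vbasis {:V}) i v) p.

Definition zero_locus (F : fieldType) (V : vectType F)
    (S : set (mpoly (\dim {:V}) F)) : set V :=
  [set v | forall p, S p -> peval p v = 0].

(* Alias of V (as a set of F-points) carrying the Zariski topology. *)
Definition zariski (F : fieldType) (V : vectType F) : Type := V.

HB.instance Definition _ (F : fieldType) (V : vectType F) :=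
  Choice.on (zariski V).

Section ZariskiTopology.
Context (F : fieldType) (V : vectType F).

Definition zariski_open : set_system (zariski V) :=
  [set A | exists S, ~` A = zero_locus S].

Fact zariski_openT : zariski_open setT.
Proof.
exists [set (1 : mpoly (\dim {:V}) F)]; apply/seteqP; split=> v /=; first by move=> [].
move=> /(_ _ erefl) /eqP.
by rewrite /peval meval1 oner_eq0.
Qed.

Fact zariski_openI : setI_closed zariski_open.
Proof.
move=> A B [S AS] [T BT].
exists [set r | exists p q, [/\ S p, T q & r = p * q]].
rewrite setCI AS BT; apply/seteqP; split=> v /=.
  by case=> H r [p [q [Sp Tq ->]]]; rewrite /peval mevalM;
    have := H; [move=> /(_ p Sp)|move=> /(_ q Tq)]; rewrite /peval => ->;
    rewrite ?mul0r ?mulr0.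
move=> H; apply: contrapT => /not_orP[/existsNP[p /not_implyP[Sp p0]]].
move=> /existsNP[q /not_implyP[Tq q0]].
have /eqP := H (p * q) (ex_intro _ p (ex_intro _ q (And3 Sp Tq erefl))).
by rewrite /peval mevalM mulf_eq0 => /orP[] /eqP.
Qed.

Fact zariski_open_bigU (I : Type) (f : I -> set (zariski V)) :
  (forall i, zariski_open (f i)) -> zariski_open (\bigcup_i f i).
Proof.
move=> /choice[S fS]; exists (\bigcup_i S i).
rewrite setC_bigcup; apply/seteqP; split=> v /=.
  by move=> H p [i _ Sip]; have := H i Logic.I; rewrite fS; apply.
by move=> H i _; rewrite fS => p Sip; apply: H; exists i.
Qed.

HB.instance Definition _ := isOpenTopological.Build (zariski V)
  zariski_openT zariski_openI zariski_open_bigU.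

End ZariskiTopology.

Lemma zariski_closedP (F : fieldType) (V : vectType F) (A : set (zariski V)) :
  closed A <-> exists S, A = zero_locus S.
Proof.
rewrite -openC; split=> -[S AS]; exists S; first by rewrite -AS setCK.
by rewrite setCK.
Qed.

Definition general_linear (F : fieldType) (H : vectType F) : set 'End(H) :=
  [set g | lker g == 0%VS].

Definition is_GL_subgroup (F : fieldType) (H : vectType F)
    (G : set 'End(H)) : Prop :=
  [/\ G `<=` @general_linear F H, G \1%VF,
      forall g h, G g -> G h -> G (g \o h)%VF
    & forall g, G g -> G g^-1%VF].

(* GL(H) is a principal open subset of End(H), and a polynomial in the matrix
   entries and 1/det vanishes at the same points of GL(H) as its product with a
   large power of det.  So the Zariski topology of GL(H), and hence that of G,
   is induced by the Zariski topology of the vector space End(H). *)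
Definition zariski_connected (F : fieldType) (H : vectType F)
    (G : set 'End(H)) : Prop :=
  connected (G : set (zariski 'End(H))).

Definition acts_irreducibly (F : fieldType) (H : vectType F)
    (G : set 'End(H)) : Prop :=
  {:H}%VS != 0%VS /\
  forall U : {vspace H},
    (forall g, G g -> (g @: U <= U)%VS) -> U = 0%VS \/ U = {:H}%VS.

Definition is_min (A : set nat) (m : nat) : Prop :=
  A m /\ lbound A m.

(* Main.v *)
(* For W in H let f(W) be the minimum of dim(gV :&: W) over g in G.  When the sets
   of minimizing g for two subspaces always meet, f is supermodular; it is also
   G-invariant.  Hence the maximizers of dim H * f(W) - dim V * dim W are closed
   under sums, the largest one is G-stable, so it is 0 or H by irreducibility,
   and there the function vanishes.

   Minimality of dim(gV :&: W) is a rank condition, implied by the nonvanishing of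
   some det (A g B), which is a linear form in a tensor power of g.  So it is enough
   that the image of G under a polynomial matrix representation is not the union
   of two proper linear sections.  Only linear sections of a fixed
   finite-dimensional space occur, so that dimension replaces the Hilbert basis
   theorem: the image has finitely many irreducible components; by homogeneity
   they are pairwise disjoint, hence clopen, and connectedness leaves only one. *)
From HB Require Import structures.
Require Import Defs.
From mathcomp Require Import all_boot all_order all_algebra.
From mathcomp Require Import boolp classical_sets topology.
From mathcomp Require Import -(notations) mpoly.
From mathcomp Require Import perm zify.

Import GRing.Theory Num.Theory.
Import VectorInternalTheory.
Local Open Scope ring_scope.
Local Open Scope classical_set_scope.

(** * Minimizers and maximizers of integer measures *)

Lemma exists_minimizer {T : Type} (P : T -> Prop) (m : T -> nat) :
  (exists x, P x) -> exists2 x, P x & forall y, P y -> (m x <= m y)%N.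
Proof.
move=> [x0 Px0].
have exP : exists n, `[< exists2 x, P x & m x = n >].
  by exists (m x0); apply/asboolP; exists x0.
case: (ex_minnP exP) => n /asboolP[x Px <-] minx.
by exists x => // y Py; apply/minx/asboolP; exists y.
Qed.

Lemma exists_maximizer {T : Type} (P : T -> Prop) (m : T -> nat) (b : nat) :
  (forall x, P x -> (m x <= b)%N) ->
  (exists x, P x) -> exists2 x, P x & forall y, P y -> (m y <= m x)%N.
Proof.
move=> mb /(exists_minimizer P (fun x => b - m x)%N)[x Px minx].
exists x => // y Py; have := minx y Py; have := mb y Py; have := mb x Px; lia.
Qed.

(** * Linear sections and their irreducible components *)

Section IrreducibleSubspaces.
Context {F : fieldType} {U : vectType F}.
Implicit Types (A : set U) (X Y Z : {vspace U}) (s t : seq {vspace U}).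

Definition covers s A := forall a, A a -> exists2 Z, Z \in s & a \in Z.

(** Irreducibility for the topology whose closed sets are the finite unions of linear subspaces; the
    empty list [s] forces [A] to be nonempty. *)
Definition irreducible A :=
  forall s, covers s A -> exists2 Z, Z \in s & forall a, A a -> a \in Z.

(** Induction on $\dim X$: if a cover [s] witnesses reducibility, none of its members contains the
    section by [X], so each $X\cap Z$ is a proper subspace of [X]; the decompositions of these are
    concatenated. *)
Lemma irreducible_decomposition A X :
  exists2 s, (forall Z, Z \in s -> irreducible [set a | A a /\ a \in Z]) &
    covers s [set a | A a /\ a \in X].
Proof.
have [n] := ubnP (\dim X); elim: n X => // n IHn X ltXn.
have [Xirr|] := pselect (irreducible [set a | A a /\ a \in X]).
  exists [:: X] => [Z|a /= [Aa Xa]]; first by rewrite inE => /eqP ->.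
  by exists X; rewrite ?inE.
move=> /existsNP[s /not_implyP[sX sN]].
have {sN} ltsX Z : Z \in s -> (\dim (X :&: Z)%VS < n)%N.
  move=> Zs; rewrite -ltnS (leq_trans _ ltXn)// ltnS.
  rewrite (ltn_leqif (dimv_leqif_sup (capvSl X Z))).
  apply: contraPN sN => XZ; apply; exists Z => // a /= [_ aX].
  by move/subvP/(_ a aX): XZ; rewrite memv_cap => /andP[].
have : exists2 t, forall Z, Z \in t -> irreducible [set a | A a /\ a \in Z] &
    forall Z, Z \in s -> covers t [set a | A a /\ a \in (X :&: Z)%VS].
  elim: s {sX} ltsX => [|Y s IHs] lts; first by exists [::].
  have [t t1 t2] := IHs (fun Z Zs => lts Z (mem_behead (s := Y :: s) Zs)).
  have [u u1 u2] := IHn _ (lts Y (mem_head _ _)).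
  exists (u ++ t) => [Z|Z].
    by rewrite mem_cat => /orP[/u1|/t1].
  rewrite inE => /predU1P[->|Zs] a Ha.
    by have [Z' Z's aZ'] := u2 a Ha; exists Z'; rewrite // mem_cat Z's.
  by have [Z' Z's aZ'] := t2 Z Zs a Ha; exists Z'; rewrite // mem_cat Z's orbT.
move=> [t t1 t2]; exists t => // a /= [Aa aX].
have [Z Zs aZ] := sX a (conj Aa aX).
by apply: (t2 Z Zs); rewrite /= memv_cap aX.
Qed.

(** Inverses on [A] alone suit a multiplicative [rho], for which [rho \1] is just an idempotent.
    Linearity makes preimages of subspaces subspaces. *)
Definition linearly_homogeneous A :=
  forall a b, A a -> A b -> exists f g : 'End(U),
    [/\ f b = a, forall x, A x -> A (f x), forall x, A x -> A (g x)
      & forall x, A x -> f (g x) = x /\ g (f x) = x].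

(* Some point lies on exactly one irreducible component, hence by homogeneity
   every point does: the components are pairwise disjoint. *)
Lemma homogeneous_irreducible_or_split A :
  linearly_homogeneous A -> A !=set0 ->
  irreducible A \/
  exists X s, [/\ covers (X :: s) A, exists2 a, A a & a \in X,
    exists2 a, A a & exists2 Z, Z \in s & a \in Z
    & forall a Z, A a -> a \in X -> Z \in s -> a \notin Z].
Proof.
move=> homA [a0 Aa0].
(* A cover of minimal length by irreducible sections is irredundant; its members serve as the
   components. *)
have [|s [sirr sA] smin] := exists_minimizer (fun s =>
    (forall Z, Z \in s -> irreducible [set a | A a /\ a \in Z]) /\ covers s A) size.
  have [s s1 s2] := irreducible_decomposition A fullv; exists s; split=> // a Aa.
  by apply: s2; rewrite /= memvf.
case: s => [|X s] in sirr sA smin *; first by have [] := sA _ Aa0.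
have Xirr := sirr X (mem_head _ _).
have sNA : ~ covers s A.
  move=> sA'; suff: (size (X :: s) <= size s)%N by rewrite ltnn.
  by apply: smin; split=> // Z Zs; apply: sirr; rewrite inE Zs orbT.
have XNcover : ~ exists2 Z, Z \in s & forall a, A a -> a \in X -> a \in Z.
  move=> [Z Zs XZ]; apply: sNA => a Aa.
  have [Y] := sA a Aa; rewrite inE => /predU1P[->|Ys] aY; last by exists Y.
  by exists Z => //; exact: XZ.
have NcoverX Z : Z \in s -> ~ forall a, A a -> a \in Z -> a \in X.
  move=> Zs ZX; suff: (size (X :: s) <= size (X :: rem Z s))%N.
    by rewrite /= size_rem//; case: (s) Zs => //= *; lia.
  apply: smin; split=> [Y|a Aa].
    rewrite inE => /predU1P[->//|/mem_rem Ys]; apply: sirr.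
    by rewrite inE Ys orbT.
  have [Y] := sA a Aa; rewrite inE => /predU1P[->|Ys] aY.
    by exists X; rewrite ?mem_head.
  have [YZ|YZ] := eqVneq Y Z.
    by exists X; rewrite ?mem_head// ZX// -YZ.
  exists Y => //; rewrite inE; apply/orP; right.
  by have := perm_mem (perm_to_rem Zs) Y; rewrite Ys inE (negPf YZ) /= => <-.
have [sE|[Y Ys]] : s = [::] \/ exists Y, Y \in s.
  by case: (s) => [|Y ?]; [left|right; exists Y; rewrite mem_head].
  left=> t tA; have [|Z Zt XZ] := Xirr t; first by move=> a [/tA].
  exists Z => // a Aa; apply: XZ; split=> //.
  by have [Z'] := sA a Aa; rewrite sE inE => /eqP ->.
right; exists X, s; split=> //.
- apply: contrapT => XA; apply: XNcover; exists Y => // a Aa aX.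
  by exfalso; apply: XA; exists a.
- apply: contrapT => YA; apply: (NcoverX Y Ys) => a Aa aY.
  by exfalso; apply: YA; exists a => //; exists Y.
move=> a Z Aa aX Zs; apply/negP => aZ.
have [b Ab bNs] : exists2 b, A b & ~ exists2 Z, Z \in s & b \in Z.
  apply: contrapT => bN; apply: sNA => b Ab.
  by apply: contrapT => ?; apply: bN; exists b.
have [f [g [fab Af Ag fg]]] := homA b a Ab Aa.
(* The preimages of the components under [h] cover the irreducible set $A\cap Y'$, so one of them
   contains it. *)
have image_in (h : 'End(U)) Y' : Y' \in X :: s -> (forall x, A x -> A (h x)) ->
    exists2 Z', Z' \in X :: s & forall x, A x -> x \in Y' -> h x \in Z'.
  move=> Y's Ah; have [|_ /mapP[Z' Z's ->] Y'Z'] := sirr Y' Y's [seq h @^-1: Z' | Z' <- X :: s]%VS.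
    move=> x /= [Ax xY']; have [Z' Z's hxZ'] := sA (h x) (Ah x Ax).
    exists (h @^-1: Z')%VS; last by rewrite -memv_preim.
    exact: (map_f (lfun_preim h) Z's).
  by exists Z' => // x Ax xY'; rewrite memv_preim; exact: Y'Z'.
(* [f] sends [a] to [b], which lies on [X] only, so it sends every component through [a] into
   [X]. *)
have fX Y' : Y' \in X :: s -> a \in Y' -> forall x, A x -> x \in Y' -> f x \in X.
  move=> Y's aY'; have [Z' Z's Y'Z'] := image_in f Y' Y's Af.
  move: Z's; rewrite inE => /predU1P[<-//|Z's].
  by exfalso; apply: bNs; exists Z' => //; rewrite -fab Y'Z'.
(* [g] undoes [f] on [A] and sends $A\cap X$ into a single [Z'], so $A\cap X$ and $A\cap Z$ both lie
   in [Z']. Minimality rules out the latter if $Z'=X$ and the former otherwise. *)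
have [Z' + XZ'] := image_in g X (mem_head _ _) Ag.
rewrite inE => /predU1P[Z'X|Z's].
  apply: (NcoverX Z Zs) => x Ax xZ; rewrite -(fg x Ax).2 -Z'X; apply: XZ'; first exact: Af.
  by apply: (fX Z) => //; rewrite inE Zs orbT.
apply: XNcover; exists Z' => // x Ax xX; rewrite -(fg x Ax).2; apply: XZ'; first exact: Af.
by apply: (fX X) => //; rewrite mem_head.
Qed.

End IrreducibleSubspaces.

(** * Polynomial functions and Zariski-closed sets *)

Section PolynomialFunctions.
Context {F : fieldType} {V : vectType F}.

Definition polynomial_fun (f : V -> F) :=
  exists p : mpoly (\dim {:V}) F, forall v, f v = peval p v.

Lemma polynomial_fun_cst c : polynomial_fun (fun=> c).
Proof. by exists (mpolyC _ c) => v; rewrite /peval mevalC. Qed.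

Lemma polynomial_funM f g : polynomial_fun f -> polynomial_fun g ->
  polynomial_fun (fun v => f v * g v).
Proof.
by move=> [p pf] [q qg]; exists (p * q) => v; rewrite pf qg /peval mevalM.
Qed.

Lemma polynomial_fun_sum (I : Type) (r : seq I) (f : I -> V -> F) :
  (forall i, polynomial_fun (f i)) ->
  polynomial_fun (fun v => \sum_(i <- r) f i v).
Proof.
move=> pf; elim: r => [|i r [p IHr]].
  by exists 0 => v; rewrite /peval meval0 big_nil.
have [q qf] := pf i.
by exists (q + p) => v; rewrite big_cons IHr qf /peval mevalD.
Qed.

Lemma polynomial_fun_prod (I : Type) (r : seq I) (f : I -> V -> F) :
  (forall i, polynomial_fun (f i)) ->
  polynomial_fun (fun v => \prod_(i <- r) f i v).
Proof.
move=> pf; elim: r => [|i r [p IHr]].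
  by exists 1 => v; rewrite /peval meval1 big_nil.
have [q qf] := pf i.
by exists (q * p) => v; rewrite big_cons IHr qf /peval mevalM.
Qed.

Lemma polynomial_fun_linear (f : {linear V -> F^o}) : polynomial_fun f.
Proof.
have [p pE] : polynomial_fun
    (fun v => \sum_i coord (vbasis {:V}) i v * f (vbasis {:V})`_i).
  apply: polynomial_fun_sum => i; apply: polynomial_funM; last exact: polynomial_fun_cst.
  by exists (mpolyX _ (mnm1 i)) => v; rewrite /peval mevalXU.
exists p => v; rewrite -pE {1}(coord_vbasis (memvf v)) linear_sum.
by apply: eq_bigr => i _; rewrite linearZ.
Qed.

Lemma closed_polynomial_zeros f : polynomial_fun f ->
  closed ([set v | f v = 0] : set (zariski V)).
Proof.
move=> [p pf]; apply/zariski_closedP; exists [set p].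
apply/seteqP; split=> v /=; first by rewrite pf => p0 _ ->.
by rewrite pf; apply.
Qed.

(** A matrix lies in [X] iff it equals its projection to [X], and the entries of the difference are
    linear in those of [rho v]. *)
Lemma closed_preim_vspace m n (rho : V -> 'M[F]_(m, n)) (X : {vspace 'M[F]_(m, n)}) :
  (forall i j, polynomial_fun (fun v => rho v i j)) ->
  closed ([set v | rho v \in X] : set (zariski V)).
Proof.
move=> rhop.
pose f i j v := (rho v - projv X (rho v)) i j.
have -> : [set v | rho v \in X] = \bigcap_(ij in setT) [set v | f ij.1 ij.2 v = 0].
  apply/seteqP; split=> v /=; first by move=> vX ij _; rewrite /f /= projv_id// subrr mxE.
  move=> fv; suff -> : rho v = projv X (rho v) by exact: memv_proj.
  by apply/eqP; rewrite -subr_eq0; apply/eqP/matrixP => i j; rewrite [RHS]mxE; exact: fv (i, j) Logic.I.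
apply: closed_bigI => -[i j] _; apply: closed_polynomial_zeros => /=.
have [p pE] : polynomial_fun (fun v => \sum_k \sum_l
    rho v k l * (delta_mx k l - projv X (delta_mx k l)) i j).
  do 2!apply: polynomial_fun_sum => ?.
  by apply: polynomial_funM => //; exact: polynomial_fun_cst.
exists p => v; rewrite -pE /f {1 2}[rho v]matrix_sum_delta.
rewrite linear_sum -sumrB summxE; apply: eq_bigr => k _.
rewrite linear_sum -sumrB summxE; apply: eq_bigr => l _.
by rewrite linearZ -scalerBr mxE.
Qed.

End PolynomialFunctions.

(** * Determinants as linear forms in tensor powers *)

Section TensorPower.
Context {F : fieldType}.

(* The r-fold Kronecker power of M, in coordinates. *)
Definition tensor_mx (r : nat) {m n : nat} (M : 'M[F]_(m, n)) :
    'M_(#|{ffun 'I_r -> 'I_m}|, #|{ffun 'I_r -> 'I_n}|) :=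
  \matrix_(a, b) \prod_i M ((enum_val a : {ffun _}) i) ((enum_val b : {ffun _}) i).

Lemma tensor_mxM r m n p (A : 'M[F]_(m, n)) (B : 'M[F]_(n, p)) :
  tensor_mx r (A *m B) = tensor_mx r A *m tensor_mx r B.
Proof.
apply/matrixP => a b; rewrite !mxE.
under eq_bigr do rewrite mxE.
rewrite bigA_distr_bigA (reindex (@enum_val {ffun 'I_r -> 'I_n} predT)) /=;
  last exact/onW_bij/enum_val_bij.
by apply: eq_bigr => c _; rewrite !mxE big_split.
Qed.

(** The products $\prod_i M_{i,s(i)}$ of the Leibniz expansion are entries of [tensor_mx r M]; [C]
    collects their signs. *)
Lemma det_tensor_mx r : exists C, forall M : 'M[F]_r, \det M = \tr (C *m tensor_mx r M).
Proof.
pose rank (f : {ffun 'I_r -> 'I_r}) := enum_rank f.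
exists (\sum_(s : 'S_r) (-1) ^+ s *: delta_mx (rank [ffun i => s i]) (rank [ffun i => i])) => M.
rewrite mulmx_suml linear_sum; apply: eq_bigr => s _ /=.
rewrite -scalemxAl linearZ /=; congr (_ * _).
rewrite /mxtrace (bigD1 (rank [ffun i => s i])) //= [X in _ = _ + X]big1 => [|a aN].
  rewrite addr0 mxE (bigD1 (rank [ffun i => i])) //= [X in _ = _ + X]big1 => [|b bN].
    rewrite addr0 !mxE !eqxx mul1r; apply: eq_bigr => i _.
    by rewrite !enum_rankK !ffunE.
  by rewrite mxE (negPf bN) andbF mul0r.
by rewrite mxE big1 // => b _; rewrite mxE (negPf aN) mul0r.
Qed.

(** Multiplicativity of [tensor_mx] and cyclicity of the trace absorb [A] and [B] into [C]. *)
Lemma det_mul_tensor_mx {r m n} (A : 'M[F]_(r, m)) (B : 'M[F]_(n, r)) :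
  exists C, forall M, \det (A *m M *m B) = \tr (C *m tensor_mx r M).
Proof.
have [C CE] := det_tensor_mx r.
exists (tensor_mx r B *m C *m tensor_mx r A) => M.
by rewrite CE !tensor_mxM !mulmxA mxtrace_mulC !mulmxA.
Qed.

Lemma trace_form_vspace {n} (C : 'M[F]_n) :
  exists Z : {vspace 'M[F]_n}, forall M, (M \in Z) = (\tr (C *m M) == 0).
Proof.
exists (lker (linfun (mxtrace \o mulmx C : {linear 'M[F]_n -> F^o}))) => M.
by rewrite memv_ker lfunE.
Qed.

End TensorPower.

(** * Matrices of linear maps and their rank *)

Section LinearMapMatrix.
Context {F : fieldType}.

Lemma f2mx_comp (U V W : vectType F) (g : 'Hom(V, W)) (f : 'Hom(U, V)) :
  f2mx (g \o f)%VF = f2mx f *m f2mx g.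
Proof.
apply/row_matrixP => i; rewrite !rowE mulmxA.
have := congr1 v2r (comp_lfunE g f (r2v (delta_mx 0 i))).
by rewrite !unlock /= !r2vK.
Qed.

Lemma f2mxE (U V : vectType F) (f : 'Hom(U, V)) i j :
  f2mx f i j = v2r (f (r2v (delta_mx 0 i))) 0 j.
Proof. by rewrite unlock /= !r2vK -rowE mxE. Qed.

Lemma polynomial_fun_f2mx (V : vectType F) i j :
  polynomial_fun (fun f : 'End(V) => f2mx f i j).
Proof.
pose phi (f : 'End(V)) : F^o := f2mx f i j.
have phi_lin : linear phi.
  move=> c f g; rewrite /phi !f2mxE; do !rewrite lfunE /=.
  by rewrite linearP !mxE.
pose phiL := GRing.isLinear.Build _ _ _ _ phi phi_lin.
pose phi' : {linear 'End(V) -> F^o} := HB.pack phi phiL.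
exact: (polynomial_fun_linear phi').
Qed.

Lemma dim_limg_f2mx (U V : vectType F) (f : 'Hom(U, V)) : \dim (limg f) = \rank (f2mx f).
Proof.
have := limg_ker_dim f fullv.
rewrite capfv dimvf => H; apply/eqP; rewrite -(eqn_add2l (\dim (lker f))) H.
rewrite /dimv /lker. rewrite mx2vsK mxrank_ker subnK // rank_leq_row //.
Qed.

Lemma rank_ge_det {m n} {M : 'M[F]_(m, n)} {r} (A : 'M_(r, m)) (B : 'M_(n, r)) :
  \det (A *m M *m B) != 0 -> (r <= \rank M)%N.
Proof.
rewrite -unitfE => /mxrank_unit rE; rewrite -[r in (r <= _)%N]rE.
exact: leq_trans (mxrankM_maxl _ _) (mxrankM_maxr _ _).
Qed.

(** Gaussian elimination reduces [M] to [pid_mx], and the rectangular [pid_mx] factors cut out its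
    identity block. *)
Lemma det_rank {m n} (M : 'M[F]_(m, n)) :
  exists A B, \det (A *m M *m B : 'M_(\rank M)) != 0.
Proof.
exists (pid_mx (\rank M) *m invmx (col_ebase M)), (invmx (row_ebase M) *m pid_mx (\rank M)).
have E : invmx (col_ebase M) *m M *m invmx (row_ebase M) = pid_mx (\rank M).
  rewrite -{2}(mulmx_ebase M) !mulmxA mulVmx ?col_ebase_unit// mul1mx.
  by rewrite mulmxK ?row_ebase_unit.
rewrite -2!mulmxA [M *m (_ *m _)]mulmxA [invmx _ *m _]mulmxA [invmx _ *m (_ *m _)]mulmxA E.
rewrite !mul_pid_mx !minnn (minn_idPr (rank_leq_col M)) minnn (minn_idPr (rank_leq_row M)).
by rewrite pid_mx_1 det1 oner_neq0.
Qed.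

End LinearMapMatrix.

(** * Representations of Zariski-connected groups *)

Section ConnectedLinearGroups.
Context {F : fieldType} {H : vectType F} {G : set 'End(H)}.
Hypotheses (Ggroup : is_GL_subgroup G) (Gconn : zariski_connected G).

(** If the image split into [X] and the members of [s], the preimages of the two pieces would be
    disjoint nonempty closed sets covering [G], against connectedness. *)
Lemma representation_irreducible {N} (rho : 'End(H) -> 'M[F]_N) :
  (forall g h, rho (g \o h)%VF = rho h *m rho g) ->
  (forall i j, polynomial_fun (fun g => rho g i j)) ->
  irreducible [set rho g | g in G].
Proof.
case: Ggroup => GL G1 GM GV rhoM rhop.
have homG : linearly_homogeneous [set rho g | g in G].
  move=> _ _ [g Gg <-] [h Gh <-].
  have GgV : G (g \o h^-1)%VF by apply: GM => //; exact: GV.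
  have GhV : G (h \o g^-1)%VF by apply: GM => //; exact: GV.
  have [/GL/eqP/eqP g0 /GL/eqP/eqP h0] := (Gg, Gh).
  (* Since [rho] reverses products, these right multiplications preserve the image; the first
     carries [rho h] to [rho g]. *)
  exists (linfun (mulmxr (rho (g \o h^-1)%VF))), (linfun (mulmxr (rho (h \o g^-1)%VF))).
  split=> [|_ [k Gk <-]|_ [k Gk <-]|_ [k Gk <-]]; rewrite !lfunE /= -!rhoM.
  - by rewrite -comp_lfunA lker0_compVf// comp_lfun1r.
  - by exists ((g \o h^-1) \o k)%VF => //; exact: GM.
  - by exists ((h \o g^-1) \o k)%VF => //; exact: GM.
  - by rewrite -!comp_lfunA lker0_compKf// lker0_compVKf// lker0_compKf// lker0_compVKf.
have [|//|[X [s [sG [_ [g Gg <-] gX] [_ [h Gh <-] [Y Ys hY]] dis]]]] :=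
  homogeneous_irreducible_or_split _ homG; first by exists (rho \1%VF), \1%VF.
pose Xg : set (zariski 'End(H)) := [set k | rho k \in X].
pose sg : set (zariski 'End(H)) := \big[setU/set0]_(Z <- s) [set k | rho k \in Z].
have sgP k : sg k <-> exists2 Z, Z \in s & rho k \in Z.
  rewrite /sg -bigcup_seq; split=> [[Z /= Zs kZ]|[Z Zs kZ]]; by exists Z.
have Xcl : closed Xg by exact: closed_preim_vspace.
have scl : closed sg by apply: closed_bigsetU => Z _; exact: closed_preim_vspace.
have XG : G `&` Xg = G.
  apply: Gconn; first by exists g.
    exists (~` sg); first by rewrite openC.
    apply/seteqP; split=> k [Gk kX]; split=> //.
      by move=> /sgP[Z Zs kZ]; have := dis (rho k) Z (imageP _ Gk) kX Zs; rewrite kZ.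
    have [|Z] := sG (rho k); first by exists k.
    by rewrite inE => /predU1P[->//|Zs kZ]; case: kX; apply/sgP; exists Z.
  by exists Xg.
have hX : rho h \in X by have : G h := Gh; rewrite -XG => -[].
by have := dis (rho h) Y (imageP _ Gh) hX Ys; rewrite hY.
Qed.

(** Otherwise two proper linear sections would cover the irreducible image of [G]. *)
Lemma common_nonvanishing {r1 r2} {A1 : 'M[F]_(r1, dim H)} {B1} {A2 : 'M_(r2, dim H)} {B2} :
  (exists2 g, G g & \det (A1 *m f2mx g *m B1) != 0) ->
  (exists2 g, G g & \det (A2 *m f2mx g *m B2) != 0) ->
  exists g, [/\ G g, \det (A1 *m f2mx g *m B1) != 0 & \det (A2 *m f2mx g *m B2) != 0].
Proof.
move=> [g1 Gg1 d1] [g2 Gg2 d2]; apply: contrapT => noG.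
have [C1 C1E] := det_mul_tensor_mx A1 B1.
have [C2 C2E] := det_mul_tensor_mx A2 B2.
(* The block sum makes both determinants linear forms on one representation. *)
pose rho (g : 'End(H)) := block_mx (tensor_mx r1 (f2mx g)) 0 0 (tensor_mx r2 (f2mx g)).
have rhoM g h : rho (g \o h)%VF = rho h *m rho g.
  by rewrite /rho f2mx_comp !tensor_mxM mulmx_block !mulmx0 !mul0mx !addr0 !add0r.
have tensorp r a b : polynomial_fun (fun g : 'End(H) => tensor_mx r (f2mx g) a b).
  have [p pE] : polynomial_fun (fun g : 'End(H) =>
      \prod_i f2mx g ((enum_val a : {ffun 'I_r -> _}) i) ((enum_val b : {ffun 'I_r -> _}) i)).
    by apply: polynomial_fun_prod => i; exact: polynomial_fun_f2mx.
  by exists p => g; rewrite mxE pE.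
have rhop i j : polynomial_fun (fun g => rho g i j).
  rewrite /rho; case: (split_ordP i) => i' ->; case: (split_ordP j) => j' ->.
  - have [p pE] := tensorp _ i' j'; by exists p => g; rewrite block_mxEul pE.
  - have [p pE] := polynomial_fun_cst (V := 'End(H)) 0.
    by exists p => g; rewrite block_mxEur mxE -pE.
  - have [p pE] := polynomial_fun_cst (V := 'End(H)) 0.
    by exists p => g; rewrite block_mxEdl mxE -pE.
  - have [p pE] := tensorp _ i' j'; by exists p => g; rewrite block_mxEdr pE.
have det1E g : \det (A1 *m f2mx g *m B1) = \tr (block_mx C1 0 0 0 *m rho g).
  by rewrite C1E mulmx_block mxtrace_block !mul0mx ?mulmx0 !addr0 mxtrace0 addr0.
have det2E g : \det (A2 *m f2mx g *m B2) = \tr (block_mx 0 0 0 C2 *m rho g).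
  by rewrite C2E mulmx_block mxtrace_block !mul0mx ?mulmx0 !add0r mxtrace0 add0r.
have [Z1 Z1E] := trace_form_vspace (block_mx C1 0 0 (0 : 'M_#|{ffun 'I_r2 -> 'I_(dim H)}|)).
have [Z2 Z2E] := trace_form_vspace (block_mx (0 : 'M_#|{ffun 'I_r1 -> 'I_(dim H)}|) 0 0 C2).
have [|Z] := representation_irreducible rho rhoM rhop [:: Z1; Z2].
  move=> _ [g Gg <-].
  have [d1g|d1g] := eqVneq (\det (A1 *m f2mx g *m B1)) 0.
    by exists Z1; rewrite ?mem_head// Z1E -det1E d1g.
  have [d2g|d2g] := eqVneq (\det (A2 *m f2mx g *m B2)) 0.
    by exists Z2; rewrite ?inE ?eqxx ?orbT// Z2E -det2E d2g.
  by exfalso; apply: noG; exists g.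
rewrite !inE => /orP[]/eqP-> Z0.
  by have := Z0 _ (imageP _ Gg1); rewrite Z1E -det1E (negPf d1).
by have := Z0 _ (imageP _ Gg2); rewrite Z2E -det2E (negPf d2).
Qed.

End ConnectedLinearGroups.

(** * The generic dimension of $gV\cap W$ *)

Section GenericIntersection.
Context {F : fieldType} {H : vectType F} {G : set 'End(H)}.
Hypotheses (Ggroup : is_GL_subgroup G) (Gconn : zariski_connected G).
Implicit Types (g h : 'End(H)) (V W X Y : {vspace H}).

(** The map $(1-\pi_W)\,g\,\pi_V$ has image $(1-\pi_W)(gV)$ and $\ker(1-\pi_W)=W$; rank-nullity on
    $gV$ concludes. *)
Lemma dim_cap_rank V W :
  exists P Q : 'M[F]_(dim H), forall g, lker g == 0%VS ->
    (\dim (g @: V :&: W) + \rank (P *m f2mx g *m Q) = \dim V)%N.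
Proof.
exists (f2mx (projv V)), (f2mx (\1 - projv W)%VF) => g g0.
have kerW : lker (\1 - projv W)%VF = W.
  apply/vspaceP => v; rewrite memv_ker !lfun_simp /= subr_eq0.
  by apply/eqP/idP => [->|/projv_id ->//]; exact: memv_proj.
rewrite -!f2mx_comp -dim_limg_f2mx !limg_comp limg_proj -{1}kerW limg_ker_dim.
by rewrite limg_dim_eq// (eqP g0) capv0.
Qed.

Lemma exists_generic V W :
  exists2 g, G g & forall h, G h -> (\dim (g @: V :&: W) <= \dim (h @: V :&: W))%N.
Proof. by apply: exists_minimizer; case: Ggroup => _ G1 _ _; exists \1%VF. Qed.

Definition generic_dim V W : nat := \dim (xget \1%VF
  [set g | G g /\ forall h, G h -> (\dim (g @: V :&: W) <= \dim (h @: V :&: W))%N] @: V :&: W).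

Lemma generic_dim_attained V W :
  exists2 g, G g & \dim (g @: V :&: W) = generic_dim V W.
Proof.
rewrite /generic_dim; case: xgetP => [g _ [Gg _]|]; first by exists g.
by have [g Gg gmin] := exists_generic V W; move=> /(_ g) [].
Qed.

Lemma generic_dim_le V W {g} : G g -> (generic_dim V W <= \dim (g @: V :&: W))%N.
Proof.
rewrite /generic_dim; case: xgetP => [h _ [_ hmin]|]; first exact: hmin.
by have [h Gh hmin] := exists_generic V W; move=> /(_ h) [].
Qed.

(** A minimizer has maximal rank in [dim_cap_rank]. A determinant detecting that rank is nonzero
    only where the rank is at least as large, that is, at minimizers. *)
Lemma generic_dim_det V W :
  exists r (A : 'M[F]_(r, dim H)) (B : 'M[F]_(dim H, r)),
    (exists2 g, G g & \det (A *m f2mx g *m B) != 0) /\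
    forall g, G g -> \det (A *m f2mx g *m B) != 0 ->
      \dim (g @: V :&: W) = generic_dim V W.
Proof.
have GL g : G g -> lker g == 0%VS by case: Ggroup => GL _ _ _ /GL /eqP/eqP.
have [P [Q PQ]] := dim_cap_rank V W.
have [g Gg gE] := generic_dim_attained V W.
have [A [B AB]] := det_rank (P *m f2mx g *m Q).
exists _, (A *m P), (Q *m B); split=> [|h Gh].
  by exists g => //; rewrite !mulmxA in AB *.
have -> : A *m P *m f2mx h *m (Q *m B) = A *m (P *m f2mx h *m Q) *m B.
  by rewrite !mulmxA.
move=> /rank_ge_det rk; apply/eqP; rewrite eqn_leq generic_dim_le// andbT.
have := PQ g (GL g Gg); have := PQ h (GL h Gh); rewrite gE; lia.
Qed.

(** For one [g] minimizing for both $X+Y$ and $X\cap Y$, the sum of $gV\cap X$ and $gV\cap Y$ lies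
    in $gV\cap(X+Y)$ and their intersection in $gV\cap X\cap Y$. *)
Lemma generic_dim_supermodular V X Y :
  (generic_dim V X + generic_dim V Y <=
   generic_dim V (X + Y)%VS + generic_dim V (X :&: Y)%VS)%N.
Proof.
have [r1 [A1 [B1 [nz1 gen1]]]] := generic_dim_det V (X + Y)%VS.
have [r2 [A2 [B2 [nz2 gen2]]]] := generic_dim_det V (X :&: Y)%VS.
have [g [Gg /gen1 <- // /gen2 <- //]] := common_nonvanishing Ggroup Gconn nz1 nz2.
apply: leq_trans (leq_add (generic_dim_le V X Gg) (generic_dim_le V Y Gg)) _.
rewrite -dimv_sum_cap leq_add// dimvS//.
  by rewrite subv_cap subv_add !capvSl /= addvS// capvSr.
by rewrite subv_cap capvS ?capvSr// (subv_trans (capvSl _ _))// capvSl.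
Qed.

(** [h] maps $h^{-1}gV\cap X$ injectively into $gV\cap hX$. *)
Lemma generic_dim_img V X h : G h -> (generic_dim V X <= generic_dim V (h @: X)%VS)%N.
Proof.
case: Ggroup => GL _ GM GV Gh; have /eqP/eqP h0 := GL h Gh.
have [g Gg <-] := generic_dim_attained V (h @: X)%VS.
have Ghg : G (h^-1 \o g)%VF by apply: GM => //; exact: GV.
apply: leq_trans (generic_dim_le V X Ghg) _.
rewrite -(limg_dim_eq (f := h)) ?(eqP h0) ?capv0// dimvS//.
apply: subv_trans (limg_cap _ _ _) _.
by rewrite -limg_comp lker0_compVKf.
Qed.

Lemma generic_dim_leqr V X : (generic_dim V X <= \dim X)%N.
Proof.
by have [g _ <-] := generic_dim_attained V X; rewrite dimvS// capvSr.
Qed.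

Lemma generic_dim_fullv V : generic_dim V fullv = \dim V.
Proof.
have [g Gg <-] := generic_dim_attained V fullv; case: Ggroup => GL _ _ _.
by rewrite capvf limg_dim_eq// (eqP (GL g Gg)) capv0.
Qed.

Hypothesis Girr : acts_irreducibly G.

(* [excess X] is dim H * f(X) - dim V * dim X shifted by dim V * dim H to stay in [nat]. *)
Lemma generic_dim_bound V W :
  (\dim {:H} * generic_dim V W <= \dim V * \dim W)%N.
Proof.
pose excess X := (\dim {:H} * generic_dim V X + \dim V * (\dim {:H} - \dim X))%N.
have dimH X : (\dim X <= \dim {:H})%N by rewrite dimvS// subvf.
have [|M0 _ M0max] := exists_maximizer (fun=> True) excess
    (\dim {:H} * \dim {:H} + \dim V * \dim {:H})%N _ (ex_intro _ W Logic.I).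
  move=> X _; rewrite leq_add// leq_mul// ?leq_subr//.
  exact: leq_trans (generic_dim_leqr V X) (dimH X).
have [M Mmax Mlargest] := exists_maximizer (fun X => forall Y, (excess Y <= excess X)%N)
    (fun X => \dim X) (\dim {:H}) (fun X _ => dimH X) (ex_intro _ M0 (fun Y => M0max Y Logic.I)).
(* Dimension is modular, so [excess] is supermodular: for a maximizer [X], $X+M$ is again a
   maximizer, and [M] has the largest dimension among these. *)
have sub_M X : (excess M <= excess X)%N -> (X <= M)%VS.
  move=> XM; suff sumM Y : (excess Y <= excess (X + M)%VS)%N.
    have := Mlargest _ sumM; rewrite (geq_leqif (dimv_leqif_sup (addvSr X M))).
    by rewrite subv_add => /andP[].
  have := Mmax Y; have := Mmax (X :&: M)%VS; move: XM; rewrite /excess.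
  have := generic_dim_supermodular V X M; have := dimv_sum_cap X M.
  have := (dimH X, dimH M, dimH (X + M)%VS, dimH (X :&: M)%VS).
  move=> [[[? ?] ?] ?]; nia.
have GM g : G g -> (g @: M <= M)%VS.
  case: Ggroup => GL _ _ _ Gg; apply: sub_M.
  rewrite /excess limg_dim_eq ?(eqP (GL g Gg)) ?capv0// leq_add2r leq_mul2l.
  by rewrite generic_dim_img// orbT.
(* At both $0$ and [H] the unshifted function vanishes, leaving only the shift. *)
have excessM : excess M = (\dim V * \dim {:H})%N.
  rewrite /excess; case: (Girr.2 M GM) => ->.
    have := generic_dim_leqr V 0; rewrite dimv0 leqn0 => /eqP ->.
    by rewrite muln0 subn0.
  by rewrite generic_dim_fullv subnn muln0 addn0 mulnC.
have := Mmax W; rewrite excessM /excess mulnBr.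
have := leq_mul (leqnn (\dim V)) (dimH W); lia.
Qed.

End GenericIntersection.

Theorem theorem5p1 (F : fieldType) (H : vectType F) (G : set 'End(H))
    (Ggroup : is_GL_subgroup G) (Gconn : zariski_connected G)
    (Girr : acts_irreducibly G) (V W : {vspace H}) :
  exists2 m : nat,
    is_min [set \dim (g @: V :&: W) | g in G] m &
    m%:R <= (\dim V)%:R * (\dim W)%:R / (\dim {:H})%:R :> rat.
Proof.
exists (generic_dim (G := G) V W).
  split; first exact: generic_dim_attained.
  by move=> _ [g Gg <-]; exact: generic_dim_le.
have H0 : (0 < \dim {:H})%N by rewrite lt0n dimv_eq0; case: Girr.
rewrite ler_pdivlMr ?ltr0n// -!natrM ler_nat mulnC.
exact: generic_dim_bound.
Qed.
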